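(* If $G$ and $H$ are two balanced realizations of the same joint degree matrix $\mathcal{J}$, then there is a sequence of restricted swap operations transforming $G$ into a graph $G'$ such that $\mathbf{s}_{G'}(v)=\mathbf{s}_H(v)$ for every vertex $v\in V$.
   Context: All graphs are simple, without isolated vertices, on a labeled vertex set. For a graph $G$ with maximum degree $\Delta$, $V_i$ denotes the set of vertices of degree $i$. The degree spectrum $\mathbf{s}_G(v)$ of a vertex $v$ is the vector with $\Delta$ components whose $i$-th entry $\mathbf{s}_G(v)_i$ is the number of neighbors of $v$ of degree $i$. The joint degree matrix $\mathcal{J}(G)$ is the $\Delta\times\Delta$ matrix with $\mathcal{J}_{ij}$ equal to the number of edges $xy$ with $x\in V_i$, $y\in V_j$. Given a graphical joint degree matrix $\mathcal{J}$, fix the vertex set $V$ and its partition $V=V_1\cup\dots\cup V_\Delta$ (the sizes $|V_i|$ are determined by $\mathcal{J}$); a realization of $\mathcal{J}$ is a graph on $V$ with joint degree matrix $\mathcal{J}$ in which the set of degree-$i$ vertices is exactly $V_i$. A swap $ac,bd\Rightarrow bc,ad$ (for distinct $a,b,c,d$ with $ac,bd\in E$, $bc,ad\notin E$) replaces edges $ac,bd$ by $bc,ad$; it is a restricted swap operation if $a,b\in V_i$ for some $i$ (such a swap preserves the joint degree matrix). Define $A_j(j)=2\mathcal{J}_{jj}/|V_j|$ and, for $i\ne j$, $A_j(i)=\mathcal{J}_{ij}/|V_j|$ (the average of $\mathbf{s}_G(v)_i$ over $v\in V_j$). The set $V_j$ is balanced in $G$ if for every $v\in V_j$ and every $i$,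 $\mathbf{s}_G(v)_i\in\{\lfloor A_j(i)\rfloor,\lceil A_j(i)\rceil\}$; a realization is balanced if every $V_j$ is balanced in it. *)

(* Defs.v *)
From HB Require Import structures.
From mathcomp Require Import all_boot all_order all_algebra.
From Stdlib Require Import Relation_Operators.

Set Implicit Arguments.
Unset Strict Implicit.
Unset Printing Implicit Defensive.

Import Order.TTheory GRing.Theory Num.Theory.

Record sgraph (T : finType) := SGraph {
  edges : {set {set T}};
  edges_card2 : forall e, e \in edges -> #|e| = 2
}.

Section Degrees.
Variables (T : finType) (G : sgraph T).

Definition adj (x y : T) : bool := [set x; y] \in edges G.

Definition deg (v : T) : nat := #|[set w | adj v w]|.

Definition max_deg : nat := \max_(v : T) deg v.

Definition degclass (k : nat) : {set T} := [set v | deg v == k].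

(* Indices of vectors and matrices of size Delta start at 0, so i : 'I_Delta
   stands for the degree i.+1.  Delta is a parameter rather than max_deg G so
   that spectra of different graphs have the same type; is_realization below
   imposes max_deg G = Delta. *)
Definition spectrum (Delta : nat) (v : T) : 'rV[nat]_Delta :=
  \row_(i < Delta) #|[set w in degclass i.+1 | adj v w]|.

Definition jdm (Delta : nat) : 'M[nat]_Delta :=
  \matrix_(i < Delta, j < Delta)
    #|[set e in edges G |
        [exists x in degclass i.+1, exists y in degclass j.+1,
           e == [set x; y]]]|.

End Degrees.

Section Realizations.
Variables (T : finType) (Delta : nat).
Variables (J : 'M[nat]_Delta) (V : 'I_Delta -> {set T}).

Definition is_realization (G : sgraph T) : Prop :=
  [/\ forall v, 0 < deg G v,
      max_deg G = Delta,
      forall i : 'I_Delta, degclass G i.+1 = V i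
    & jdm G Delta = J].

Definition avg_spectrum (j i : 'I_Delta) : rat :=
  (if i == j then (2 * J j j)%N%:R / #|V j|%:R
   else (J i j)%:R / #|V j|%:R)%R.

Definition class_balanced (G : sgraph T) (j : 'I_Delta) : Prop :=
  forall (v : T) (i : 'I_Delta), v \in V j ->
    Posz (spectrum G Delta v ord0 i) = Num.floor (avg_spectrum j i)
    \/ Posz (spectrum G Delta v ord0 i) = Num.ceil (avg_spectrum j i).

Definition is_balanced (G : sgraph T) : Prop :=
  forall j : 'I_Delta, class_balanced G j.

End Realizations.

Section Swaps.
Variables (T : finType) (Delta : nat) (V : 'I_Delta -> {set T}).

(* The swap ac, bd => bc, ad turns G into G'. *)
Definition is_swap (G : sgraph T) (a b c d : T) (G' : sgraph T) : Prop :=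
  [/\ uniq [:: a; b; c; d],
      adj G a c /\ adj G b d,
      ~~ adj G b c /\ ~~ adj G a d
    & edges G' = (edges G :\: [set [set a; c]; [set b; d]])
                   :|: [set [set b; c]; [set a; d]]].

Definition restricted_swap (G G' : sgraph T) : Prop :=
  exists (a b c d : T) (i : 'I_Delta),
    [/\ a \in V i, b \in V i & is_swap G a b c d G'].

Definition restricted_swaps : sgraph T -> sgraph T -> Prop :=
  clos_refl_trans (sgraph T) restricted_swap.

End Swaps.

(* Main.v *)
Require Import Defs.
From HB Require Import structures.
From mathcomp Require Import all_boot all_order all_algebra.
From mathcomp Require Import all_fingroup zify.
From Stdlib Require Import Relation_Operators.

(* The spectra of G form a matrix with rows indexed by vertices and columns by
   degrees.  Balancedness says that inside a degree class each column takes
   only two consecutive values, the same for G and H, so the two matrices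
   behave like 0/1 matrices; their row sums (the degrees) and their column sums
   over each class (entries of the joint degree matrix) agree.  As in Ryser's
   theorem, such matrices are connected by 2x2 exchanges.  An exchange at rows
   v, w and columns i, k, where v has more neighbours than w in V_i and fewer
   in V_k, is realized by a swap vc, wd => wc, vd with c in V_i, d in V_k; as v
   and w have the same degree, it affects the spectra of v and w only. *)

Set Implicit Arguments.
Unset Strict Implicit.
Unset Printing Implicit Defensive.

Lemma sum_eq_ltn_ex (I : finType) (P : pred I) (F E : I -> nat) (i : I) :
  P i -> F i < E i -> \sum_(j | P j) F j = \sum_(j | P j) E j ->
  exists2 j, P j & E j < F j.
Proof.
move=> Pi lti eqs; case: (pickP [pred j | P j & E j < F j]) => [j /andP[]|no].
  by exists j.
suff: \sum_(j | P j) F j < \sum_(j | P j) E j by rewrite eqs ltnn.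
rewrite (bigD1 i) //= [ltnRHS](bigD1 i) //= -addSn leq_add //.
by apply: leq_sum => j /andP[Pj _]; move: (no j); rewrite /= Pj /= ltnNge => /negbFE.
Qed.

(** * Exchanges in matrices whose rows are split into classes *)

Section Exchange.
Variables (T I : finType) (cl : T -> nat).
Implicit Types (M N : {ffun T * I -> nat}) (u v w : T) (i k c : I).

(** Transposing entries, rather than adding and subtracting one, makes the operation an involution
    and turns column sums over a class into a reindexing. For an [exchangeable] quadruple the
    transposed entries differ by one, so row sums survive too. *)
Definition exchange M v w i k : {ffun T * I -> nat} :=
  [ffun p => if (p.2 == i) || (p.2 == k) then M (tperm v w p.1, p.2) else M p].

Definition exchangeable M v w i k : Prop :=
  [/\ cl v = cl w, M (v, i) = (M (w, i)).+1 & M (w, k) = (M (v, k)).+1].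

Definition exchange_step M M' : Prop :=
  exists v w i k, exchangeable M v w i k /\ M' = exchange M v w i k.

Lemma exchange_stepC M M' : exchange_step M M' -> exchange_step M' M.
Proof.
move=> [v [w [i [k [[evw Hi Hk] ->]]]]]; exists w, v, i, k; split; last first.
  apply/ffunP=> -[u c]; rewrite !ffunE /= (tpermC w v).
  by case: (_ || _) => //=; rewrite tpermK.
by split; rewrite // !ffunE /= ?eqxx ?orbT tpermL tpermR.
Qed.

Lemma exchange_reachC M N :
  clos_refl_trans _ exchange_step M N -> clos_refl_trans _ exchange_step N M.
Proof.
elim=> [A B /exchange_stepC|A|A B C _ AB _ BC]; [exact: rt_step|exact: rt_refl|].
exact: rt_trans BC AB.
Qed.

Lemma cl_tperm v w u : cl v = cl w -> cl (tperm v w u) = cl u.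
Proof. by move=> evw; case: tpermP => // ->. Qed.

(** Subtracting [f], which sees only the class of a row, leaves a 0/1 matrix. *)
Definition near_base (f : nat -> I -> nat) M : Prop :=
  forall u c, f (cl u) c <= M (u, c) <= (f (cl u) c).+1.

Lemma exchange_near_base f M v w i k :
  cl v = cl w -> near_base f M -> near_base f (exchange M v w i k).
Proof.
move=> evw bM u c; rewrite ffunE /=; case: ifP => // _.
by rewrite -(cl_tperm u evw).
Qed.

Lemma exchange_col_sum M v w i k (t : nat) c : cl v = cl w ->
  \sum_(u | cl u == t) exchange M v w i k (u, c) = \sum_(u | cl u == t) M (u, c).
Proof.
move=> evw; case: (boolP ((c == i) || (c == k))) => cik; last first.
  by apply: eq_bigr => u _; rewrite ffunE /= (negbTE cik).
rewrite [RHS](reindex_inj (@perm_inj _ (tperm v w))) /=.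
by apply: eq_big => u; [rewrite cl_tperm | rewrite ffunE /= cik].
Qed.

Lemma exchange_id M v w i k u c :
  u != v -> u != w -> exchange M v w i k (u, c) = M (u, c).
Proof. by move=> uv uw; rewrite ffunE /= tpermD 1?eq_sym // if_same. Qed.

Lemma exchange_row_sum M v w i k u : exchangeable M v w i k ->
  \sum_c exchange M v w i k (u, c) = \sum_c M (u, c).
Proof.
move=> [evw Hi Hk].
have ik : k != i by apply/eqP => eki; move: Hk; rewrite eki; lia.
have rest x : \sum_(c | (c != i) && (c != k)) exchange M v w i k (x, c)
            = \sum_(c | (c != i) && (c != k)) M (x, c).
  by apply: eq_bigr => c /andP[ci ck]; rewrite ffunE /= (negbTE ci) (negbTE ck).
have [->|uv] := eqVneq u v; last have [->|uw] := eqVneq u w; last first.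
  by apply: eq_bigr => c _; apply: exchange_id.
all: rewrite (bigD1 i) // (bigD1 k) //= [RHS](bigD1 i) // [in RHS](bigD1 k) //=.
all: rewrite !ffunE /= !eqxx orbT /= ?tpermL ?tpermR.
all: by rewrite rest; lia.
Qed.

(* Correct the rows one after the other: where row [v] has too much in
   column [i] and too little in column [k], equality of the column sums over
   the class of [v] yields a row [w] with which [M] or [N] can be exchanged so
   as to decrease the number of disagreements in row [v]. *)
Lemma exchange_connected (f : nat -> I -> nat) M N :
  near_base f M -> near_base f N ->
  (forall u, \sum_c M (u, c) = \sum_c N (u, c)) ->
  (forall t c, \sum_(u | cl u == t) M (u, c) = \sum_(u | cl u == t) N (u, c)) ->
  clos_refl_trans _ exchange_step M N.
Proof.
move=> bM bN rMN cMN.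
(* Generalizing [enum T] gives a list of the rows that may still disagree; the outer induction
   shortens it. *)
have : forall u, u \notin enum T -> forall c, M (u, c) = N (u, c).
  by move=> u; rewrite mem_enum.
elim: (enum T) => [|v s IHs] in M N bM bN rMN cMN *.
  by move=> eMN; have -> : M = N by [apply/ffunP=> -[u c]; apply: eMN];
     exact: rt_refl.
have [n] := ubnP #|[set c | M (v, c) != N (v, c)]|.
elim: n => // n IHn in M N bM bN rMN cMN * => ltn eMN.
case: (pickP [pred c | M (v, c) != N (v, c)]) => [c0 /= neq0|eqv]; last first.
  apply: IHs => // u us c; have [->|uv] := eqVneq u v.
    by move: (eqv c) => /= /negbFE/eqP.
  by apply: eMN; rewrite inE negb_or uv.
have [i lti] : exists i, N (v, i) < M (v, i).
  case: (ltngtP (M (v, c0)) (N (v, c0))) neq0 => // lt0 _; last by exists c0.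
  have [//|i _ ?] := @sum_eq_ltn_ex I xpredT (fun c => M (v, c))
    (fun c => N (v, c)) c0 _ lt0 (rMN v).
  by exists i.
have [//|k _ ltk] := @sum_eq_ltn_ex I xpredT (fun c => N (v, c))
  (fun c => M (v, c)) i _ lti (esym (rMN v)).
(* The difference [M - N] is larger in column [i] than in column [k] at row [v], while both columns
   of it sum to zero over the class; hence some row [w] has the opposite inequality. *)
have [w /eqP clw ltw] : exists2 w, cl w == cl v
    & M (w, i) + N (w, k) < M (w, k) + N (w, i).
  apply: (@sum_eq_ltn_ex _ _ _ _ v) => //; first by lia.
  by rewrite !big_split /= !cMN addnC.
have wv : w != v by apply/eqP => ewv; move: ltw; rewrite ewv; lia.
have ws : w \in v :: s.
  by apply: contraLR ltw => /eMN e; rewrite !e; lia.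
have := (bM v i, bM v k, bM w i, bM w k).
have := (bN v i, bN v k, bN w i, bN w k).
rewrite clw => -[[[Nvi Nvk] Nwi] Nwk] [[[Mvi Mvk] Mwi] Mwk].
(* The disagreement in column [i] disappears. Column [k] already was a disagreement, so it cannot
   become a new one. *)
have fewer (M' N' : {ffun T * I -> nat}) : M' (v, i) = N' (v, i) ->
    (forall c, c != i -> M' (v, c) != N' (v, c) -> M (v, c) != N (v, c)) ->
    #|[set c | M' (v, c) != N' (v, c)]| < n.
  move=> ei sub; rewrite ltnS in ltn; apply: leq_trans ltn.
  apply/proper_card/properP; split; last first.
    by exists i; rewrite inE ?ei ?eqxx // gtn_eqF.
  apply/subsetP => c; rewrite !inE; have [->|ci] := eqVneq c i; last exact: sub.
  by rewrite ei eqxx.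
have vs : v \in v :: s by exact: mem_head.
have out M' a b u c : a \in v :: s -> b \in v :: s -> u \notin v :: s ->
    exchange M' a b i k (u, c) = M' (u, c).
  by move=> a_s b_s us; apply: exchange_id; apply: contraNneq us => ->.
(* Relative to the base, row [v] reads 1, 0 in [M] and 0, 1 in [N] at columns [i], [k], so the test
   compares the 0/1 entries of [M] in row [w]. If the one at [k] does not exceed the one at [i], the
   choice of [w] forces row [w] of [N] to read 1, 0, and [N] can be exchanged; otherwise row [w] of
   [M] reads 0, 1, and [M] can. *)
case: (leqP (M (w, k) + M (v, i)) (M (w, i) + M (v, k)).+1) => leM.
- have exN : exchangeable N w v i k by split; [by []|lia|lia].
  apply: (rt_trans _ _ _ (exchange N w v i k)); last first.
    by apply/exchange_reachC/rt_step; exists w, v, i, k.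
  apply: IHn => //.
  + exact: exchange_near_base.
  + by move=> u; rewrite exchange_row_sum.
  + by move=> t c; rewrite exchange_col_sum.
  + apply: fewer; first by rewrite ffunE /= eqxx tpermR /=; lia.
    move=> c ci; rewrite ffunE /= (negbTE ci) /=; have [-> _|//] := eqVneq c k.
    by rewrite ltn_eqF.
  + by move=> u us c; rewrite out // eMN.
- have exM : exchangeable M v w i k by split; [by []|lia|lia].
  apply: (rt_trans _ _ _ (exchange M v w i k)).
    by apply: rt_step; exists v, w, i, k.
  apply: IHn => //.
  + exact: exchange_near_base.
  + by move=> u; rewrite exchange_row_sum.
  + by move=> t c; rewrite exchange_col_sum.
  + apply: fewer; first by rewrite ffunE /= eqxx tpermL /=; lia.
    move=> c ci; rewrite ffunE /= (negbTE ci) /=; have [-> _|//] := eqVneq c k.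
    by rewrite ltn_eqF.
  + by move=> u us c; rewrite out // eMN.
Qed.
End Exchange.

(** * The effect of a swap on the number of neighbours in a set *)

Section Swap.
Variable T : finType.
Implicit Types (G : sgraph T) (D : {set T}) (x y p q a b c d : T).

Lemma set2_eq x y p q :
  ([set x; y] == [set p; q]) = (x == p) && (y == q) || (x == q) && (y == p).
Proof.
apply/eqP/idP => [/setP e|/orP[]/andP[/eqP-> /eqP->] //]; last by rewrite setUC.
move: (e x) (e y) (e p) (e q); rewrite !inE !eqxx ?orbT /= (eq_sym p) (eq_sym p).
rewrite (eq_sym q) (eq_sym q).
by case: (x == p); case: (x == q); case: (y == p); case: (y == q).
Qed.

Lemma adjC G x y : adj G x y = adj G y x.
Proof. by rewrite /adj setUC. Qed.

Lemma adj_neq G x y : adj G x y -> x != y.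
Proof. by move=> /edges_card2; rewrite cards2; case: (x != y). Qed.

Definition nbr_in G D x : nat := #|[set y in D | adj G x y]|.

Lemma nbr_inE G D x : nbr_in G D x = \sum_(y in D) adj G x y.
Proof.
rewrite /nbr_in -sum1_card big_mkcond [RHS]big_mkcond.
by apply: eq_bigr => y _; rewrite !inE; case: (y \in D); case: adj.
Qed.

Lemma sum_set2_eq D x p q : p != q ->
  \sum_(y in D) ([set x; y] == [set p; q]) =
  (x == p) * (q \in D) + (x == q) * (p \in D).
Proof.
move=> pq.
have one r : \sum_(y in D) (y == r) = (r \in D).
  rewrite big_mkcond (bigD1 r) //= eqxx big1 ?addn0; first by case: (r \in D).
  by move=> y /negbTE ->; rewrite if_same.
rewrite -(one q) -(one p) !big_distrr -big_split /=; apply: eq_bigr => y _.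
rewrite set2_eq; have [->|] := eqVneq x p; last by case: (x == q); case: (y == p).
by rewrite (negbTE pq); case: (y == q).
Qed.

Lemma swap_exists G a b c d : uniq [:: a; b; c; d] ->
  adj G a c -> adj G b d -> ~~ adj G b c -> ~~ adj G a d ->
  exists G', is_swap G a b c d G'.
Proof.
move=> u ac bd bc ad.
have card2 e : e \in (edges G :\: [set [set a; c]; [set b; d]])
                       :|: [set [set b; c]; [set a; d]] -> #|e| = 2.
  rewrite !inE => /orP[/andP[_ /edges_card2]//|/orP[]/eqP->]; rewrite cards2.
    by move: u; rewrite /= !inE; have [->|//] := eqVneq b c; rewrite andbF.
  by move: u; rewrite /= !inE; have [->|//] := eqVneq a d; rewrite !orbT.
by exists (SGraph card2).
Qed.

(** Summing over [D] the edge-by-edge balance [ind]. Removed edges are added on the left, which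
    avoids truncated subtraction. *)
Lemma nbr_in_swap G G' a b c d D x : is_swap G a b c d G' ->
  nbr_in G' D x + (x == a) * (c \in D) + (x == c) * (a \in D)
                + (x == b) * (d \in D) + (x == d) * (b \in D)
  = nbr_in G D x + (x == b) * (c \in D) + (x == c) * (b \in D)
                 + (x == a) * (d \in D) + (x == d) * (a \in D).
Proof.
move=> [u [ac bd] [bc ad] eG'].
move: u; rewrite /= !inE !negb_or !andbT.
move=> /and3P[/and3P[nab nac nad] /andP[nbc nbd] ncd].
have ind e : (e \in edges G') + (e == [set a; c]) + (e == [set b; d])
           = (e \in edges G) + (e == [set b; c]) + (e == [set a; d]).
  rewrite eG' !inE.
  have [->|e1] := eqVneq e [set a; c].
    by rewrite [_ \in edges G]ac !set2_eq (negbTE nab) (negbTE nac) (negbTE nad)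
      (negbTE ncd) !andbF.
  have [->|e2] := eqVneq e [set b; d].
    by rewrite [_ \in edges G]bd !set2_eq (eq_sym b a) (eq_sym d c)
      (negbTE nab) (negbTE nbc) (negbTE nbd) (negbTE ncd) !andbF.
  have [->|e3] := eqVneq e [set b; c].
    by rewrite (negbTE bc : _ \in edges G = false) !set2_eq (eq_sym b a)
      (negbTE nab) (negbTE nbd).
  have [->|e4] := eqVneq e [set a; d].
    by rewrite (negbTE ad : _ \in edges G = false).
  by case: (e \in edges G).
have : \sum_(y in D) (adj G' x y + ([set x; y] == [set a; c])
                                  + ([set x; y] == [set b; d]))
     = \sum_(y in D) (adj G x y + ([set x; y] == [set b; c])
                                 + ([set x; y] == [set a; d])).
  by apply: eq_bigr => y _; apply: ind.
by rewrite !big_split /= -!nbr_inE !sum_set2_eq // !addnA.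
Qed.

(** The vertices [c] and [d] trade [a] and [b] as neighbours, which [D] does not tell apart, so
    their terms cancel. *)
Lemma nbr_in_class_swap G G' a b c d D x : is_swap G a b c d G' ->
  (a \in D) = (b \in D) ->
  nbr_in G' D x + (x == a) * (c \in D) + (x == b) * (d \in D)
  = nbr_in G D x + (x == b) * (c \in D) + (x == a) * (d \in D).
Proof.
have cancel (n' n p q r s t u : nat) :
  n' + p + q + r + s = n + t + q + u + s -> n' + p + r = n + t + u by lia.
move=> sw ab; have := nbr_in_swap D x sw; rewrite -ab; exact: cancel.
Qed.

(** Otherwise the transposition of [v] and [w] would inject the neighbours of [v] in [D] into those
    of [w]; it matters when [w] itself is a neighbour of [v]. The condition [c != w] keeps the four
    vertices of the later swap distinct. *)
Lemma private_neighbour G D v w : (v \in D) = (w \in D) ->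
  nbr_in G D w < nbr_in G D v ->
  exists c, [/\ c \in D, adj G v c, ~~ adj G w c & c != w].
Proof.
move=> vwD; rewrite /nbr_in => lt.
case: (pickP [pred c | [&& c \in D, adj G v c, ~~ adj G w c & c != w]]) => [c|no].
  by move=> /and4P[*]; exists c.
suff: #|[set y in D | adj G v y]| <= #|[set y in D | adj G w y]| by lia.
rewrite -(card_imset _ (@perm_inj _ (tperm v w))); apply/subset_leq_card/subsetP.
move=> _ /imsetP[y /[!inE] /andP[yD vy] ->].
have yv : y != v by rewrite eq_sym (adj_neq vy).
have [e|yw] := eqVneq y w.
  by rewrite e tpermR vwD -e yD adjC.
rewrite tpermD 1?eq_sym // yD /=.
by move: (no y); rewrite /= yD vy yw andbT /= => /negbFE.
Qed.
End Swap.

(** * Lifting exchanges of spectra to restricted swaps *)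

Section Spectra.
Variables (T : finType) (Delta : nat) (V : 'I_Delta -> {set T}) (cl : T -> nat).
Hypothesis cl_bounds : forall v, 0 < cl v <= Delta.
Hypothesis V_cl : forall i, V i = [set v | cl v == i.+1].
Implicit Types (G : sgraph T) (v w x : T) (i j k l : 'I_Delta).

Definition spectra G : {ffun T * 'I_Delta -> nat} :=
  [ffun p => spectrum G Delta p.1 ord0 p.2].

Lemma cl_index v : {i : 'I_Delta | cl v = i.+1}.
Proof.
have lt : (cl v).-1 < Delta by move: (cl_bounds v); lia.
by exists (Ordinal lt) => /=; move: (cl_bounds v); lia.
Qed.

Lemma degclass_cl G i : deg G =1 cl -> degclass G i.+1 = V i.
Proof. by move=> degG; rewrite V_cl; apply/setP => v; rewrite !inE degG. Qed.

Lemma spectraE G x l : deg G =1 cl -> spectra G (x, l) = nbr_in G (V l) x.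
Proof. by move=> degG; rewrite ffunE mxE degclass_cl. Qed.

Lemma sum_spectra G x : deg G =1 cl -> \sum_l spectra G (x, l) = cl x.
Proof.
move=> degG; have -> : cl x = nbr_in G setT x.
  by rewrite -degG; apply: eq_card => y; rewrite !inE.
rewrite nbr_inE; under eq_bigr do rewrite spectraE // nbr_inE.
rewrite (exchange_big_dep (mem setT)) /=; last by move=> *; rewrite inE.
apply: eq_bigr => y _; have [i yi] := cl_index y.
rewrite (big_pred1 i) // => l; rewrite V_cl inE yi eqSS eq_sym.
by apply/eqP/eqP => [/val_inj|->].
Qed.

(** Private neighbours [c] of [v] in [V i] and [d] of [w] in [V k] supply the swap. Degrees stay
    equal to [cl], so the new spectra count neighbours in the same classes and the lifting can be
    iterated. *)
Lemma exchange_step_lift G M' : deg G =1 cl ->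
  exchange_step cl (spectra G) M' ->
  exists G', [/\ restricted_swap V G G', deg G' =1 cl & spectra G' = M'].
Proof.
move=> degG [v [w [i [k [[evw]]]]]]; rewrite !spectraE // => Hi Hk ->.
have vwV l : (v \in V l) = (w \in V l) by rewrite V_cl !inE evw.
have [|c [cV vc wc cw]] := @private_neighbour _ G (V i) v w (vwV i).
  by rewrite Hi.
have [|d [dV wd vd dv]] := @private_neighbour _ G (V k) w v (esym (vwV k)).
  by rewrite Hk.
have vw : v != w by apply: contraNneq wc => <-.
have cd : c != d by apply: contraNneq vd => <-.
have [|G' sw] := @swap_exists _ G v w c d _ vc wd wc vd.
  rewrite /= !inE !negb_or vw (adj_neq vc) (eq_sym v) dv (eq_sym w) cw.
  by rewrite (adj_neq wd) cd.
have inV x l j : x \in V j -> (x \in V l) = (l == j).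
  by rewrite !V_cl !inE => /eqP ->; rewrite eqSS eq_sym.
have degG' : deg G' =1 cl.
  move=> x; rewrite -degG.
  have nT H : nbr_in H setT x = deg H x.
    by apply: eq_card => y; rewrite !inE.
  have := nbr_in_class_swap x sw (etrans (in_setT v) (esym (in_setT w))).
  by rewrite !nT !inE !muln1 -!addnA [(_ == w) + _]addnC => /addIn.
exists G'; split => //.
  have [j vj] := cl_index v.
  by exists v, w, c, d, j; split; rewrite // ?V_cl inE ?vj // -evw vj.
apply/ffunP => -[x l]; rewrite spectraE // [RHS]ffunE /= !spectraE //.
have := nbr_in_class_swap x sw (vwV l).
rewrite (inV c l i) // (inV d l k) //.
have ik : k != i by apply/eqP => eki; move: Hk; rewrite eki; lia.
clear -Hi Hk ik vw.
(* Only columns [i] and [k] change, and there the entries of rows [v] and [w] differ by one, so a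
   unit shift in each row transposes them. *)
have [->|lk] := eqVneq l k; last have [->|li] := eqVneq l i; last first.
- by rewrite !muln0 !addn0.
- rewrite !muln0 !muln1 !addn0 /=; case: tpermP => [->|->|/eqP xv /eqP xw].
  + by rewrite eqxx (negbTE vw) Hi addn0 addn1 => -[].
  + by rewrite eqxx (eq_sym w) (negbTE vw) Hi addn0 addn1.
  + by rewrite (negbTE xv) (negbTE xw) !addn0.
- rewrite (negbTE ik) !muln0 !muln1 !addn0 /=.
  case: tpermP => [->|->|/eqP xv /eqP xw].
  + by rewrite eqxx (negbTE vw) Hk addn0 addn1.
  + by rewrite eqxx (eq_sym w) (negbTE vw) Hk addn0 addn1 => -[].
  + by rewrite (negbTE xv) (negbTE xw) !addn0.
Qed.

Lemma exchange_reach_lift G N : deg G =1 cl ->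
  clos_refl_trans _ (exchange_step cl) (spectra G) N ->
  exists G', [/\ restricted_swaps V G G', deg G' =1 cl & spectra G' = N].
Proof.
move=> degG; move eM: (spectra G) => M reach.
elim: reach G degG eM => {M N} [M N st|M|M N P _ IH1 _ IH2] G degG eM.
- rewrite -eM in st; have [G' [sw dG' eG']] := exchange_step_lift degG st.
  by exists G'; split; first exact: rt_step.
- by exists G; split; first exact: rt_refl.
have [G1 [sw1 d1 e1]] := IH1 _ degG eM.
have [G2 [sw2 d2 e2]] := IH2 _ d1 e1.
by exists G2; split => //; apply: rt_trans sw1 sw2.
Qed.

(** Double counting: ordered adjacent pairs in [V j] times [V i] are grouped by their edge, which
    arises from both orders if [i = j] and from one order otherwise. *)
Lemma sum_class_spectra G i j : deg G =1 cl ->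
  \sum_(v in V j) spectra G (v, i) = (if i == j then 2 else 1) * jdm G Delta i j.
Proof.
move=> degG; under eq_bigr do rewrite spectraE // nbr_inE.
rewrite mxE !degclass_cl //.
set E := [set e in edges G | _].
have -> : \sum_(v in V j) \sum_(y in V i) adj G v y
        = \sum_(p | [&& p.1 \in V j, p.2 \in V i & adj G p.1 p.2]) 1.
  rewrite pair_big /= [RHS]big_mkcond [LHS]big_mkcond; apply: eq_bigr => p _.
  by case: (_ \in V j); case: (_ \in V i); case: adj.
rewrite (partition_big (fun p => [set p.1; p.2]) (mem E)) /=; last first.
  move=> [x y] /and3P[/= xj yi xy]; rewrite !inE [_ \in edges G]xy /=.
  apply/existsP; exists y; rewrite yi; apply/existsP; exists x.
  by rewrite xj setUC eqxx.
rewrite mulnC -sum_nat_const; apply: eq_bigr => e.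
rewrite inE => /andP[eE /existsP[x /andP[xi /existsP[y /andP[yj /eqP exy]]]]].
rewrite sum1dep_card.
have xy : adj G x y by rewrite /adj -exy.
have nxy := adj_neq xy.
move: xi yj; rewrite !V_cl !inE => /eqP xi /eqP yj.
have [eij|nij] := eqVneq i j.
  have -> : 2 = #|[set (x, y); (y, x)]|.
    by rewrite cards2 xpair_eqE (negbTE nxy).
  apply: eq_card => -[p q]; rewrite !inE /= exy set2_eq !xpair_eqE.
  apply/andP/orP => [[_]|[]/andP[/eqP-> /eqP->]]; first by move/orP.
    by rewrite xi yj eij !eqxx xy.
  by rewrite xi yj eij !eqxx adjC xy orbT.
rewrite -[RHS](cards1 (y, x)); apply: eq_card => -[p q].
rewrite !inE /= exy set2_eq !xpair_eqE.
apply/andP/andP => [[/and3P[/eqP pj /eqP qi _]]|[/eqP-> /eqP->]].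
  case/orP => /andP[/eqP ep /eqP eq]; last by rewrite ep eq !eqxx.
  case/eqP: nij; apply: val_inj; move: pj; rewrite ep xi => -[] //.
by rewrite xi yj !eqxx adjC xy orbT.
Qed.
End Spectra.

(** * Balanced realizations *)

Lemma realization_deg (T : finType) (Delta : nat) (J : 'M[nat]_Delta)
    (V : 'I_Delta -> {set T}) (G : sgraph T) :
  is_realization J V G -> forall v, 0 < deg G v <= Delta.
Proof.
by move=> [pos maxG _ _] v; rewrite pos -[leqRHS]maxG; apply: leq_bigmax.
Qed.

Lemma floor_ceil_near (q : rat) (n : nat) : (0 <= q)%R ->
  Posz n = Num.floor q \/ Posz n = Num.ceil q ->
  `|Num.floor q| <= n <= `|Num.floor q|.+1.
Proof.
move=> q0; have := Num.Theory.floor_ge0 q; rewrite q0.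
rewrite Num.Theory.ceil_floor; move: (Num.floor q) => [m|m] //= _.
by case: (_ \is a _) => /=; lia.
Qed.

Theorem theorem4 (T : finType) (Delta : nat) (J : 'M[nat]_Delta)
    (V : 'I_Delta -> {set T}) (G H : sgraph T)
    (hG : is_realization J V G) (hH : is_realization J V H)
    (bG : is_balanced J V G) (bH : is_balanced J V H) :
  exists G' : sgraph T,
    restricted_swaps V G G' /\
    forall v : T, spectrum G' Delta v = spectrum H Delta v.
Proof.
have bnd := realization_deg hG.
have VG i : V i = [set v | deg G v == i.+1] by case: hG => _ _ <-.
have degH : deg H =1 deg G.
  move=> v; have [i vi] := cl_index bnd v.
  have : v \in V i by rewrite VG inE vi.
  by case: hH => _ _ <- _; rewrite inE vi => /eqP.
(* The base is the floor of the average. Indices are degrees minus one; the default 0 is never taken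
   at a vertex degree, which lies between 1 and [Delta]. *)
pose f t i := if insub t.-1 is Some j
              then `|Num.floor (avg_spectrum J V j i)| else 0.
have near K : is_balanced J V K -> near_base (deg G) f (spectra Delta K).
  move=> bK v i; have [j vj] := cl_index bnd v.
  have vV : v \in V j by rewrite VG inE vj.
  rewrite /f vj /= valK ffunE /=; apply: floor_ceil_near (bK j v i vV).
  rewrite /avg_spectrum; case: ifP => _; by rewrite Num.Theory.divr_ge0 ?Num.Theory.ler0n.
have [|G' [sw degG' eG']] :=
  @exchange_reach_lift _ _ V _ bnd VG G (spectra Delta H) (frefl _).
  apply: (exchange_connected (near G bG) (near H bH)) => [u|t c].
    by rewrite !(sum_spectra bnd VG).
  (* A value [t] that is no degree gives empty sums; any other gives a class [V j], whose column
     sums are determined by [J]. *)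
  case: (pickP (fun u => deg G u == t)) => [u /eqP ut|no]; last first.
    by rewrite !big_pred0.
  have [j uj] := cl_index bnd u.
  have sumV K : \sum_(w | deg G w == t) spectra Delta K (w, c)
              = \sum_(w in V j) spectra Delta K (w, c).
    by apply: eq_bigl => w; rewrite VG inE -uj ut.
  rewrite !sumV !(sum_class_spectra VG) //.
  by case: hG hH => [_ _ _ ->] [_ _ _ ->].
exists G'; split => // v; apply/rowP => i.
by have /ffunP/(_ (v, i)) := eG'; rewrite !ffunE.
Qed.
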